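(* Let $\alpha\neq -1,-2,\ldots$ be a real number and let $\mathcal F=(F_1,F_2)$ be a pair of finite sets of positive integers (not both empty) such that $\alpha+1$ and $\mathcal F$ are admissible. Let $G_1=I(F_1)$, $G_2=I(F_2)$, $m=|G_1|+|G_2|$, $\tilde\alpha=\alpha+M_{F_1}+M_{F_2}+2$, and $w_n^{\tilde\alpha,j}=j!\binom{n+\tilde\alpha}{j}$. Then for every integer $n\ge v_{\mathcal F}$ there is a normalization constant $\gamma_n$ (independent of $x$) such that $$L_n^{\alpha;\mathcal F}(x)=\gamma_n\det R_n(x),$$ where $R_n(x)$ is the $(m+1)\times(m+1)$ matrix with columns indexed by $j=0,\ldots,m$ whose rows are, from top to bottom: the row $\big(w_{n-v_{\mathcal F}}^{\tilde\alpha,j}\,x^{m-j}\,L_{n-v_{\mathcal F}}^{\tilde\alpha-j}(x)\big)_j$; then, for each $g\in G_1$ in increasing order, the row $\big(L_g^{-\tilde\alpha+j}(-x)\big)_j$; then, for each $g\in G_2$ in increasing order, the row $\big((L_g^{-\tilde\alpha})^{(j)}(x)\big)_j$ ($j$-th derivatives).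
   Context: $\mathbb N=\{0,1,2,\ldots\}$; $(y)_j=y(y+1)\cdots(y+j-1)$, $(y)_0=1$. Laguerre polynomials (for any real parameter): $L_n^\alpha(x)=\sum_{j=0}^n\frac{(-x)^j}{j!}\binom{n+\alpha}{n-j}$. For a finite set $F$ of positive integers, $M_F=\max F$, with $M_\emptyset=-1$; the involution $I$ is $I(F)=\{1,2,\ldots,M_F\}\setminus\{M_F-f: f\in F\}$ (so $I(\emptyset)=\emptyset$). For a pair $\mathcal F=(F_1,F_2)$ of finite sets of positive integers, let $k_i=|F_i|$, $k=k_1+k_2$, $$u_{\mathcal F}=\sum_{f\in F_1}f+\sum_{f\in F_2}f-\binom{k_1+1}{2}-\binom{k_2}{2},\qquad v_{\mathcal F}=u_{\mathcal F}+M_{F_1}+1 .$$ For $n\ge u_{\mathcal F}$ with $n-u_{\mathcal F}\notin F_1$ (in particular for every $n\ge v_{\mathcal F}$), $L_n^{\alpha;\mathcal F}(x)$ is the determinant of the $(k+1)\times(k+1)$ matrix with columns indexed by $j=0,\ldots,k$ whose rows are, from top to bottom: $\big((L_{n-u_{\mathcal F}}^\alpha)^{(j)}(x)\big)_j$; then $\big((L_f^\alpha)^{(j)}(x)\big)_j$ for $f\in F_1$ (increasing order); then $\big(L_f^{\alpha+j}(-x)\big)_j$ for $f\in F_2$ (increasing order). Admissibility: for a real $c\neq 0,-1,-2,\ldots$ put $\hat c=\max\{-[c],0\}$, where $[c]$ is the integral part (floor) of $c$. The number $c$ and the pair $\mathcal F$ are admissible if for all $x\in\mathbb N$ $$\frac{\prod_{f\in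 F_1}(x-f)\prod_{f\in F_2}(x+c+f)}{(x+c)_{\hat c}}\ge 0 .$$ Here this is applied with $c=\alpha+1$. *)

(* Defs.v *)
From HB Require Import structures.
From mathcomp Require Import all_boot all_order all_algebra.
From mathcomp Require Import finmap reals.

Set Implicit Arguments.
Unset Strict Implicit.
Unset Printing Implicit Defensive.

Import Order.TTheory GRing.Theory Num.Theory.
Local Open Scope ring_scope.

Section Scalars.
Variable R : realType.

(* binomial coefficient with an arbitrary real upper entry *)
Definition gbinom (y : R) (k : nat) : R :=
  (\prod_(i < k) (y - i%:R)) / k`!%:R.

Definition pochhammer (y : R) (j : nat) : R := \prod_(i < j) (y + i%:R).

Definition laguerre (n : nat) (alpha : R) : {poly R} :=
  \sum_(j < n.+1)
    (gbinom (n%:R + alpha) (n - j) / j`!%:R) *: (- 'X) ^+ j.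

End Scalars.

Section FiniteSets.
Local Open Scope fset_scope.

Definition pos_set (F : {fset nat}) : Prop :=
  forall f : nat, f \in F -> (0 < f)%N.

Definition maxF (F : {fset nat}) : int :=
  if F == fset0 then -1 else (\max_(f <- F) f)%N%:Z.

(* For F empty the natural maximum below is 0, so the range 1..0 is empty,
   exactly as the range 1..-1; for f in F the subtraction is exact. *)
Definition invol (F : {fset nat}) : {fset nat} :=
  let M := (\max_(f <- F) f)%N in
  [fset i in iota 1 M] `\` [fset (M - f)%N | f in F].

(* [enum_fset] gives no guarantee on the order of the elements. *)
Definition incr_seq (F : {fset nat}) : seq nat := sort leq (enum_fset F).

Definition uF (F1 F2 : {fset nat}) : int :=
  \sum_(f <- F1) f%:Z + \sum_(f <- F2) f%:Z
  - 'C(#|` F1|.+1, 2)%:Z - 'C(#|` F2|, 2)%:Z.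

Definition vF (F1 F2 : {fset nat}) : int := uF F1 F2 + maxF F1 + 1.

End FiniteSets.

Section Admissibility.
Variable R : realType.

Definition chat (c : R) : nat := `|Num.max (- Num.floor c) 0|%N.

(* Meaningful for c different from 0, -1, -2, ...; the denominator is then
   nonzero. *)
Definition admissible (c : R) (F1 F2 : {fset nat}) : Prop :=
  forall x : nat,
    0 <= ((\prod_(f <- F1) (x%:R - f%:R))
            * (\prod_(f <- F2) (x%:R + c + f%:R)))
         / pochhammer (x%:R + c) (chat c).

End Admissibility.

Section Determinants.
Variable R : realType.

(* The n x n matrix whose i-th row is the i-th function of the list, its
   columns being indexed by j = 0, ..., n - 1. *)
Definition rows_mx (n : nat) (rows : seq (nat -> {poly R})) : 'M[{poly R}]_n :=
  \matrix_(i < n, j < n) nth (fun _ => 0) rows i j.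

(* p(-x) is [p \Po (- 'X)].  The index n - u_F is used only when n >= u_F, so
   the absolute value is exact. *)
Definition laguerre_pair (alpha : R) (F1 F2 : {fset nat}) (n : nat) :
    {poly R} :=
  \det (rows_mx (#|` F1| + #|` F2|).+1
    ((fun j => (laguerre `|n%:Z - uF F1 F2|%N alpha)^`(j))
     :: [seq (fun j => (laguerre f alpha)^`(j)) | f <- incr_seq F1]
     ++ [seq (fun j => laguerre f (alpha + j%:R) \Po (- 'X))
        | f <- incr_seq F2])).

Definition alpha_tilde (alpha : R) (F1 F2 : {fset nat}) : R :=
  alpha + (maxF F1)%:~R + (maxF F2)%:~R + 2.

Definition wcoef (n : nat) (a : R) (j : nat) : R :=
  j`!%:R * gbinom (n%:R + a) j.

(* N stands for n - v_F. *)
Definition Rmx (a : R) (G1 G2 : {fset nat}) (N : nat) :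
    'M[{poly R}]_((#|` G1| + #|` G2|).+1) :=
  let m := (#|` G1| + #|` G2|)%N in
  rows_mx m.+1
    ((fun j => wcoef N a j *: ('X^(m - j) * laguerre N (a - j%:R)))
     :: [seq (fun j => laguerre g (- a + j%:R) \Po (- 'X)) | g <- incr_seq G1]
     ++ [seq (fun j => (laguerre g (- a))^`(j)) | g <- incr_seq G2]).

End Determinants.

(* Main.v *)
Require Import Defs.
From mathcomp Require Import all_boot all_order all_algebra perm.
From mathcomp Require Import finmap reals.
From mathcomp Require Import ring zify.

(** The determinant [laguerre_pair] is, up to the factor exp(-k_2 x), the
  Wronskian of the functions L_n^alpha(x) and exp(x) L_n^alpha(-x), while
  [\det Rmx] is, up to a factor x^r exp(s x), the Wronskian of
  x^a L_N^a(x), exp(x) L_g^{-a}(-x) and L_g^{-a}(x).  All four families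
  L_n^alpha(x), exp(x) L_n^alpha(-x), x^{-alpha} L_n^{-alpha}(x) and
  x^{-alpha} exp(x) L_n^{-alpha}(-x) are stable, up to a change of alpha by
  one, under the two first-order operators f |-> (f / g)' with g = 1 or
  g = exp(x), and under the inverse operators.  Since
  W(g, f_1, ..., f_r) = g^(r+1) W((f_1/g)', ..., (f_r/g)'), each such operator
  removes the lowest state of one family, or adds the lowest state of the dual
  one: this shifts the origin of a Maya diagram.  Shifting past max F turns
  the states F into the complementary dual states I(F).  The hypothesis
  alpha <> -1, -2, ... keeps all the factors met on the way nonzero.

  To stay among polynomials, a function f with f'/f = q/x + p'/p is encoded by
  the pair (p, q), and its derivatives by the iterates of p |-> x p' + q p. *)

Set Implicit Arguments.
Unset Strict Implicit.
Unset Printing Implicit Defensive.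

Import Order.TTheory GRing.Theory Num.Theory.
Local Open Scope ring_scope.

(** * Ladder relations of the Laguerre polynomials, checked coefficient by coefficient *)

Section LaguerreIdentities.
Variable R : realType.
Implicit Types (y a : R) (p q : {poly R}).

Lemma gbinom0 y : gbinom y 0 = 1.
Proof. by rewrite /gbinom big_ord0 divr1. Qed.

Lemma factS_neq0 k : 1 + k%:R != 0 :> R /\ k`!%:R != 0 :> R.
Proof. by rewrite nat1r !pnatr_eq0 -!lt0n fact_gt0. Qed.

Lemma gbinomSr y k : k.+1%:R * gbinom y k.+1 = (y - k%:R) * gbinom y k.
Proof.
rewrite /gbinom big_ord_recr /= factS natrM.
by have [? ?] := factS_neq0 k; field; do ?[apply/andP; split].
Qed.

Lemma mul_gbinom_diag y k : k.+1%:R * gbinom y k.+1 = y * gbinom (y - 1) k.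
Proof.
rewrite /gbinom big_ord_recl /= subr0 factS natrM.
have -> : \prod_(i < k) (y - (lift ord0 i)%:R) = \prod_(i < k) (y - 1 - i%:R).
  by apply: eq_bigr => i _; rewrite lift0 -natr1; ring.
by have [? ?] := factS_neq0 k; field; do ?[apply/andP; split].
Qed.

Lemma mul_gbinom_left y k : (y - k%:R) * gbinom y k = y * gbinom (y - 1) k.
Proof. by rewrite -gbinomSr mul_gbinom_diag. Qed.

Lemma gbinom_pascal y k : gbinom (y + 1) k.+1 = gbinom y k.+1 + gbinom y k.
Proof.
have [k0 _] := factS_neq0 k; rewrite nat1r in k0; apply: (mulfI k0).
by rewrite mulrDr (gbinomSr y) mul_gbinom_diag addrK -natr1; ring.
Qed.

Lemma coef_laguerre n a j : (laguerre n a)`_j =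
  if (j <= n)%N then (-1) ^+ j * gbinom (n%:R + a) (n - j) / j`!%:R else 0.
Proof.
rewrite /laguerre coef_sum.
have H (i : 'I_n.+1) : ((gbinom (n%:R + a) (n - i) / i`!%:R) *: (- 'X) ^+ i)`_j =
    if j == i then (-1) ^+ j * gbinom (n%:R + a) (n - j) / j`!%:R else 0.
  rewrite coefZ (exprNn 'X) -(rmorph_sign (@polyC R)) mul_polyC coefZ coefXn.
  by case: eqP => [->|_]; [rewrite mulr1; ring | rewrite !mulr0].
rewrite (eq_bigr _ (fun i _ => H i)) -big_mkcond /=.
case: leqP => jn; last first.
  by rewrite big_pred0 // => i; apply/negbTE; have := ltn_ord i; lia.
by rewrite (big_pred1 (Ordinal (jn : (j < n.+1)%N))).
Qed.

Lemma laguerre0 a : laguerre 0 a = 1.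
Proof. by rewrite /laguerre big_ord1 gbinom0 fact0 divr1 expr0 scale1r. Qed.

Lemma deriv_laguerre n a : (laguerre n.+1 a)^`() = - laguerre n (a + 1).
Proof.
apply/polyP=> j; rewrite coef_deriv coefN !coef_laguerre ltnS.
case: leqP => jn; last by rewrite mul0rn oppr0.
rewrite subSS factS natrM exprS -(mulr_natr _ j.+1).
rewrite (_ : n.+1%:R + a = n%:R + (a + 1)); last by rewrite -natr1; ring.
by have [? ?] := factS_neq0 j; field; do ?[apply/andP; split].
Qed.

(** This is (exp(-x) L_n^a)' = - exp(-x) L_n^(a+1); on coefficients it is Pascal's rule. *)
Lemma laguerre_sub_deriv n a :
  laguerre n a - (laguerre n a)^`() = laguerre n (a + 1).
Proof.
apply/polyP=> j; rewrite coefB coef_deriv !coef_laguerre addrA.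
have [jn|nj|->] := ltngtP j n.
- rewrite -(@prednK (n - j)) ?subn_gt0 // gbinom_pascal subnS.
  rewrite factS natrM exprS -(mulr_natr _ j.+1).
  by have [? ?] := factS_neq0 j; field; do ?[apply/andP; split].
- by rewrite mul0rn subr0.
by rewrite mul0rn subr0 subnn !gbinom0.
Qed.

(** This is (x^a L_n^a)' = (n + a) x^(a-1) L_n^(a-1): the operator x d/dx + a multiplies the j-th
    coefficient by j + a. *)
Lemma euler_laguerre n a :
  'X * (laguerre n a)^`() + a *: laguerre n a =
  (n%:R + a) *: laguerre n (a - 1).
Proof.
apply/polyP=> j; rewrite coefD !coefZ coefXM.
have -> : (if j == 0 then 0 else (laguerre n a)^`()`_j.-1) = 
    j%:R * (laguerre n a)`_j.
  by case: j => [|j]; rewrite ?mul0r //= coef_deriv mulr_natl.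
rewrite -mulrDl !coef_laguerre; case: leqP => jn; last by rewrite !mulr0.
have := mul_gbinom_left (n%:R + a) (n - j).
rewrite (_ : n%:R + a - (n - j)%:R = j%:R + a); last by rewrite natrB //; ring.
move: (gbinom _ _) => g gE; rewrite addrA.
transitivity ((-1) ^+ j * ((j%:R + a) * g) / j`!%:R); first by ring.
by rewrite gE; ring.
Qed.

(** This is (x^(a+1) exp(-x) L_n^(a+1))' = (n + 1) x^a exp(-x) L_(n+1)^a. By [euler_laguerre] it
    reduces to a contiguity relation without derivatives. *)
Lemma euler_laguerre_up n a :
  'X * (laguerre n (a + 1))^`() + (a + 1) *: laguerre n (a + 1)
    - 'X * laguerre n (a + 1) = n.+1%:R *: laguerre n.+1 a.
Proof.
rewrite euler_laguerre addrK; apply/polyP=> j.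
rewrite coefB !coefZ coefXM !coef_laguerre.
have ypred : n%:R + a = n.+1%:R + a - 1 by rewrite -natr1; ring.
have yE : n%:R + (a + 1) = n.+1%:R + a by rewrite -natr1; ring.
rewrite yE; case: j => [|j] /=.
  by rewrite !subn0 expr0 !mul1r subr0 fact0 !divr1 ypred -mul_gbinom_diag.
rewrite ltnS subSS; case: (ltngtP j n) => [jn|nj|->].
- have := mul_gbinom_diag (n.+1%:R + a) (n - j.+1).
  rewrite ypred -subSn // subSS => yg.
  (* Splitting n + 1 in this way leaves y g = (n - j) g', which is [mul_gbinom_diag]. *)
  have nE : n.+1%:R = (n - j)%:R + j.+1%:R :> R by rewrite -natrD; congr _%:R; lia.
  move: {ypred yE} (n.+1%:R + a) yg => y; rewrite {}nE.
  move: (gbinom _ _) (gbinom _ _) => g g' yg.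
  rewrite factS natrM exprS.
  have [? ?] := factS_neq0 j.
  transitivity (- (-1) ^+ j / (j.+1%:R * j`!%:R) * (y * g + j.+1%:R * g')).
    by field; do ?[apply/andP; split].
  by rewrite -yg; field; do ?[apply/andP; split].
- by rewrite !mulr0 subr0.
rewrite subnn !gbinom0 mulr0 sub0r factS natrM exprS.
by have [? ?] := factS_neq0 n; field; do ?[apply/andP; split].
Qed.

End LaguerreIdentities.

(** * Wronskians of functions encoded by pairs of polynomials *)

Section EulerWronskian.
Variable K : comNzRingType.
Implicit Types (p q : {poly K}) (f : {poly K} * {poly K}).
Implicit Types (h : nat -> {poly K}) (l : seq ({poly K} * {poly K})).

Definition euler p := 'X * p^`().

Lemma eulerM p q : euler (p * q) = euler p * q + p * euler q.
Proof. by rewrite /euler derivM; ring. Qed.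

Lemma eulerZ (c : K) p : euler (c *: p) = c *: euler p.
Proof. by rewrite /euler derivZ scalerAr. Qed.

Lemma eulerXn n : euler 'X^n = n%:R * 'X^n.
Proof.
rewrite /euler derivXn; case: n => [|n]; first by rewrite mulr0 mul0r.
by rewrite -mulr_natl exprS; ring.
Qed.

Lemma euler_sum n (F : 'I_n -> {poly K}) :
  euler (\sum_i F i) = \sum_i euler (F i).
Proof. by rewrite /euler raddf_sum mulr_sumr. Qed.

(* With h j = j this is x^j times the j-th derivative, with h = 0 the j-th
   iterate of x d/dx; the Wronskian does not depend on h (see [wronsk_gauge]). *)
Fixpoint tower h f j : {poly K} :=
  if j is j'.+1 then euler (tower h f j') + (f.2 - h j') * tower h f j'
  else f.1.

(** Coefficients of [tower h f j] on the iterates with h = 0. They do not depend on [f] and form a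
    unitriangular matrix. *)
Fixpoint tower_coef h j i : {poly K} :=
  if j is j'.+1 then
    euler (tower_coef h j' i) - h j' * tower_coef h j' i
      + (if i is i'.+1 then tower_coef h j' i' else 0)
  else (i == 0)%:R.

Lemma tower_coef_gt h j i : (j < i)%N -> tower_coef h j i = 0.
Proof.
elim: j i => [|j IH] [|i] //= ji.
by rewrite !IH ?(ltnW ji) // /euler deriv0 !mulr0 subr0 addr0.
Qed.

Lemma tower_coef_diag h j : tower_coef h j j = 1.
Proof.
by elim: j => //= j ->; rewrite tower_coef_gt // /euler deriv0 !mulr0 subr0 add0r.
Qed.

Lemma tower_expand h f n j : (j < n)%N ->
  tower h f j = \sum_(i < n) tower (fun=> 0) f i * tower_coef h j i.
Proof.
elim: j => [|j IH] jn /=.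
  case: n jn => // n _; rewrite big_ord_recl /= mulr1 big1 ?addr0 // => i _.
  by rewrite mulr0.
rewrite (IH (ltnW jn)) euler_sum mulr_sumr -big_split /=.
case: n jn {IH} => // n jn.
transitivity (\sum_(i < n.+1)
    (tower (fun=> 0) f i * (euler (tower_coef h j i) - h j * tower_coef h j i)
     + tower (fun=> 0) f i.+1 * tower_coef h j i)).
  by apply: eq_bigr => i _; rewrite eulerM /= subr0; ring.
(* The top index exceeds j, so the last term vanishes and the second sum can be reindexed by i +
   1. *)
rewrite big_split /= [X in _ + X = _]big_ord_recr /= tower_coef_gt // mulr0 addr0.
under [RHS]eq_bigr => i _ do rewrite mulrDr.
rewrite [RHS]big_split /=; congr (_ + _).
by rewrite [RHS]big_ord_recl mulr0 add0r.
Qed.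

Definition wronsk n h l : {poly K} :=
  \det (\matrix_(i < n, j < n) tower h (nth (0, 0) l i) j).

(** Changing [h] multiplies the matrix on the right by a unitriangular matrix common to all rows. *)
Lemma wronsk_gauge n h l : wronsk n h l = wronsk n (fun=> 0) l.
Proof.
rewrite /wronsk.
set M0 := (X in _ = \det X).
pose C := \matrix_(i < n, j < n) tower_coef h j i.
have -> : \matrix_(i < n, j < n) tower h (nth (0, 0) l i) j = M0 *m C.
  apply/matrixP=> i j; rewrite !mxE (tower_expand _ _ (ltn_ord j)).
  by apply: eq_bigr => k _; rewrite !mxE.
have C1 : \det C = 1.
  rewrite -det_tr det_trig; first by rewrite big1 // => i _; rewrite !mxE tower_coef_diag.
  by apply/is_trig_mxP => i j ij; rewrite !mxE tower_coef_gt.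
by rewrite det_mulmx C1 mulr1.
Qed.

(** Reduction of a Wronskian by its first function g = (1, q): dividing by g subtracts q from the
    second component, then x d/dx is applied. The powers of g and x are absorbed by the encoding. *)
Lemma wronsk_cons n q l :
  wronsk n.+1 (fun=> 0) ((1, q) :: l) =
  wronsk n (fun=> 0) [seq (euler f.1 + (f.2 - q) * f.1, f.2 - q) | f <- l].
Proof.
rewrite -(wronsk_gauge _ (fun=> q)) /wronsk (expand_det_row _ ord0).
(* In the gauge h = q the first row is (1, 0, ..., 0), and the determinant is expanded along it. *)
have t1 j : tower (fun=> q) (1, q) j.+1 = 0.
  elim: j => [|j /= ->] /=; rewrite subrr mul0r addr0 /euler ?deriv0 ?mulr0 //.
  by rewrite -[1]/(1%:P) derivC mulr0.
rewrite big_ord_recl big1 ?addr0 => [|j _]; last by rewrite !mxE lift0 t1 mul0r.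
rewrite mxE /= mul1r /cofactor expr0 mul1r; congr (\det _).
apply/matrixP=> i j; rewrite !mxE !lift0 /=.
have [il|li] := ltnP i (size l); last first.
  rewrite !nth_default ?size_map //.
  suff z h g k : g.1 = 0 -> tower h g k = 0.
    by rewrite !z ?mulr0 ?addr0 // /euler deriv0 mulr0.
  by move=> g0; elim: k => //= k ->; rewrite /euler deriv0 !mulr0 addr0.
rewrite (nth_map (0, 0)) //; move: (nth _ _ _) => f.
move: (nat_of_ord j) => {t1 il j}j.
by elim: j => //= j ->; rewrite subr0.
Qed.

(** A common factor of all functions changes only the gauge. *)
Lemma wronsk_map_shift n q l : (size l = n)%N ->
  wronsk n (fun=> 0) [seq (f.1, f.2 - q) | f <- l] = wronsk n (fun=> 0) l.
Proof.
move=> <-; rewrite -[RHS](wronsk_gauge _ (fun=> q)) /wronsk.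
congr (\det _); apply/matrixP=> i j; rewrite !mxE (nth_map (0, 0)) //.
move: (nth _ _ _) (nat_of_ord j) => f {}j.
by elim: j => //= j ->; rewrite subr0.
Qed.

Lemma tower_scale (c : K) e p q j :
  tower (fun=> 0) (c *: ('X^e * p), q) j =
  c *: ('X^e * tower (fun=> 0) (p, q + e%:R) j).
Proof.
elim: j => //= j ->; rewrite !subr0 eulerZ eulerM eulerXn -scalerAr -scalerDr.
by congr (_ *: _); ring.
Qed.

Lemma det_row_scale n (u : 'I_n -> {poly K}) (M : 'I_n -> 'I_n -> {poly K}) :
  \det (\matrix_(i, j) (u i * M i j)) = (\prod_i u i) * \det (\matrix_(i, j) M i j).
Proof.
have -> : \matrix_(i, j) (u i * M i j) =
    diag_mx (\row_i u i) *m (\matrix_(i, j) M i j).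
  by apply/matrixP=> i j; rewrite mul_diag_mx !mxE.
rewrite det_mulmx det_diag; congr (_ * _).
by apply: eq_bigr => i _; rewrite mxE.
Qed.

Lemma det_col_Xn n (M : 'I_n -> 'I_n -> {poly K}) :
  \det (\matrix_(i, j) ('X^j * M i j)) = 'X^('C(n, 2)) * \det (\matrix_(i, j) M i j).
Proof.
rewrite -det_tr -[X in _ * X]det_tr.
have -> : (\matrix_(i, j) ('X^j * M i j))^T = \matrix_(i, j) ('X^i * M j i).
  by apply/matrixP=> i j; rewrite !mxE.
have -> : (\matrix_(i, j) M i j)^T = \matrix_(i, j) M j i.
  by apply/matrixP=> i j; rewrite !mxE.
rewrite det_row_scale prodrXr; congr ('X^_ * _).
by rewrite -bin2_sum big_mkord.
Qed.

Lemma wronsk_perm n l (l' : n.-tuple _) : perm_eq l l' ->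
  exists b : bool, wronsk n (fun=> 0) l = (-1) ^+ b * wronsk n (fun=> 0) l'.
Proof.
case/tuple_permP=> s ls; exists s.
rewrite /wronsk -det_perm -det_mulmx -row_permE; congr (\det _).
apply/matrixP=> i j; rewrite !mxE ls.
by rewrite -!tnth_nth tnth_mktuple (tnth_nth (0, 0)).
Qed.

End EulerWronskian.

(** * The four Laguerre families and the first-order operators acting on them *)

Section Seeds.
Variable R : realType.
Implicit Types (a al be : R) (p q : {poly R}) (e t sg : bool).

(* (t, e, n) stands for L_n^b(y) times x^(-alpha) if t and exp(x) if e, where
   b = -alpha if t and y = -x if e. *)
Definition state := (bool * bool * nat)%type.
Implicit Types (s : state) (l : seq state).

Definition X_sgn e : {poly R} := if e then - 'X else 'X.
Definition laguerre_sgn e n a : {poly R} :=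
  if e then laguerre n a \Po (- 'X) else laguerre n a.

Lemma euler_comp_opp p : euler (p \Po (- 'X)) = euler p \Po (- 'X).
Proof.
by rewrite /euler deriv_comp derivN derivX comp_polyM comp_polyX; ring.
Qed.

Lemma euler_laguerre_deriv e n a :
  euler (laguerre_sgn e n.+1 a) = - X_sgn e * laguerre_sgn e n (a + 1).
Proof.
have H : euler (laguerre n.+1 a) = - 'X * laguerre n (a + 1).
  by rewrite /euler deriv_laguerre; ring.
case: e; rewrite //= euler_comp_opp H comp_polyM /X_sgn.
by rewrite raddfN /= comp_polyX.
Qed.

Lemma euler_laguerre_exp e n a :
  euler (laguerre_sgn e n a) =
  X_sgn e * (laguerre_sgn e n a - laguerre_sgn e n (a + 1)).
Proof.
have H : euler (laguerre n a) = 'X * (laguerre n a - laguerre n (a + 1)).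
  by rewrite /euler -laguerre_sub_deriv; ring.
by case: e; rewrite //= euler_comp_opp H comp_polyM comp_polyX raddfB.
Qed.

Lemma euler_laguerre_pow e n a :
  euler (laguerre_sgn e n a) =
  (n%:R + a)%:P * laguerre_sgn e n (a - 1) - a%:P * laguerre_sgn e n a.
Proof.
have H : euler (laguerre n a) =
    (n%:R + a)%:P * laguerre n (a - 1) - a%:P * laguerre n a.
  by rewrite !mul_polyC -euler_laguerre addrK.
case: e; rewrite //= euler_comp_opp H raddfB /= !comp_polyM !comp_polyC //.
Qed.

Lemma euler_laguerre_pow_exp e n a :
  euler (laguerre_sgn e n (a + 1)) =
  n.+1%:R * laguerre_sgn e n.+1 a
    - ((a + 1)%:P - X_sgn e) * laguerre_sgn e n (a + 1).
Proof.
have H : euler (laguerre n (a + 1)) =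
    n.+1%:R * laguerre n.+1 a - ((a + 1)%:P - 'X) * laguerre n (a + 1).
  have := euler_laguerre_up n a; rewrite -!mul_polyC polyC_natr => <-.
  by rewrite /euler; ring.
case: e; rewrite //= euler_comp_opp H raddfB /= !comp_polyM raddfB /=.
by rewrite comp_polyC comp_polyX -polyC_natr comp_polyC.
Qed.

(** The second component is x times the logarithmic derivative of the factor x^(-al), exp(x), or
    their product. *)
Definition seed al s : {poly R} * {poly R} :=
  (laguerre_sgn s.1.2 s.2 (if s.1.1 then - al else al),
   (if s.1.2 then 'X else 0) - (if s.1.1 then al%:P else 0)).

(** Effect, as al becomes al + 1, of dividing by the lowest state [(false, sg, 0)], that is 1 or
    exp(x), and differentiating. The predecessor is meant for positive levels only: level 0 of that
    family is the state removed. *)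
Definition shift sg s : state :=
  (s.1.1, s.1.2,
   if s.1.1 == (s.1.2 == sg) then s.2 else if s.1.1 then s.2.+1 else s.2.-1).

Definition up_coef sg al s : R :=
  if s.1.1 then if s.1.2 == sg then s.2%:R - al else s.2.+1%:R
  else if s.1.2 then 1 else -1.

Definition down_coef sg al s : R :=
  if s.1.1 then if s.1.2 then 1 else -1
  else if s.1.2 == sg then s.2%:R else s.2%:R + al + 1.

Lemma euler_shift_up sg al s (f := seed al s) (q := (seed al (false, sg, 0)).2) :
  (~~ s.1.1 && (s.1.2 == sg) ==> (0 < s.2))%N ->
  euler f.1 + (f.2 - q) * f.1
  = up_coef sg al s *: ('X^(~~ s.1.1) * (seed (al + 1) (shift sg s)).1).
Proof.
rewrite {}/f {}/q; case: s => [[[] e] n]; rewrite /shift /up_coef /seed /= => n0.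
- case: (e =P sg) => [->|esg] /=.
    rewrite euler_laguerre_pow -mul_polyC (opprD al 1) expr0.
    by case: sg => /=; ring.
  have -> : sg = ~~ e by case: sg e esg => [] [].
  rewrite -{1 2}[- al](subrK 1) euler_laguerre_pow_exp -mul_polyC (opprD al 1) expr0.
  by case: e {esg}; rewrite /X_sgn /=; ring.
case: (e =P sg) n0 => [->|esg] /= n0.
  case: n n0 => // n _; rewrite euler_laguerre_deriv -mul_polyC expr1.
  by case: sg; rewrite /X_sgn /=; ring.
have -> : sg = ~~ e by case: sg e esg => [] [].
rewrite euler_laguerre_exp -mul_polyC expr1.
by case: e {esg n0}; rewrite /X_sgn /=; ring.
Qed.

(** The inverse operator divides by the lowest state of the dual family, [(true, ~~ sg, 0)] at al +
    1. *)
Lemma euler_shift_down sg al s (f := seed (al + 1) (shift sg s))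
    (q := (seed (al + 1) (true, ~~ sg, 0)).2) :
  (~~ s.1.1 && (s.1.2 == sg) ==> (0 < s.2))%N ->
  euler f.1 + (f.2 - q) * f.1
  = down_coef sg al s *: ('X^(s.1.1) * (seed al s).1).
Proof.
rewrite {}/f {}/q; case: s => [[[] e] n]; rewrite /shift /down_coef /seed /= => n0.
- have aE : - al = - (al + 1) + 1 by ring.
  case: (e =P sg) => [->|esg] /=.
    rewrite euler_laguerre_exp -mul_polyC aE expr1.
    by case: sg => /=; rewrite /X_sgn; ring.
  have -> : sg = ~~ e by case: sg e esg => [] [].
  rewrite euler_laguerre_deriv -mul_polyC aE expr1.
  by case: e {esg}; rewrite /X_sgn /=; ring.
case: (e =P sg) n0 => [->|esg] /= n0.
  case: n n0 => // n _; rewrite /= euler_laguerre_pow_exp -mul_polyC expr0.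
  by case: sg; rewrite /X_sgn /=; ring.
have -> : sg = ~~ e by case: sg e esg => [] [].
rewrite euler_laguerre_pow -mul_polyC addrK expr0.
by case: e {esg n0}; rewrite /X_sgn /=; ring.
Qed.

Definition seed_wronsk al l :=
  wronsk (size l) (fun=> 0) [seq seed al s | s <- l].

(* The power of x by which [seed_wronsk] is divided to make it invariant, up to
   constants, under the shifts below. *)
Definition xdeg l :=
  ('C(count (fun s => ~~ s.1.1) l, 2) + 'C(count (fun s => s.1.1) l, 2))%N.

(** Proportionality of the Wronskians divided by their powers of x, cross-multiplied to stay among
    polynomials. *)
Definition wequiv al l be l' : Prop :=
  exists2 c : R, c != 0 &
    'X^(xdeg l') * seed_wronsk al l = c *: ('X^(xdeg l) * seed_wronsk be l').

Lemma wequiv_sym al l be l' : wequiv al l be l' -> wequiv be l' al l.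
Proof.
case=> c c0 H; exists c^-1; first by rewrite invr_eq0.
by rewrite H scalerK.
Qed.

Lemma wequiv_trans al1 l1 al2 l2 al3 l3 :
  wequiv al1 l1 al2 l2 -> wequiv al2 l2 al3 l3 -> wequiv al1 l1 al3 l3.
Proof.
case=> c c0 H12 [d d0 H23]; exists (c * d); first by rewrite mulf_neq0.
have X0 : 'X^(xdeg l2) != 0 :> {poly R} by rewrite expf_neq0 ?polyX_eq0.
apply: (mulfI X0); rewrite mulrCA H12 -scalerAr mulrCA H23.
by rewrite -!mul_polyC; ring.
Qed.

Lemma wequiv_perm al l l' : perm_eq l l' -> wequiv al l al l'.
Proof.
move=> pl; have szl := perm_size pl.
have /(wronsk_perm (l' := in_tuple _))[b] := perm_map (seed al) pl.
rewrite /= size_map => Hb.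
exists ((-1) ^+ b); first by rewrite signr_eq0.
rewrite /seed_wronsk szl Hb /xdeg !(seq.permP pl).
by rewrite mulrCA -mul_polyC rmorph_sign.
Qed.

Lemma xdeg_cons s l :
  xdeg (s :: l) = (count (fun s' => s'.1.1 == s.1.1) l + xdeg l)%N.
Proof.
case: s => [[[] e] n]; rewrite /xdeg /= !binS bin1.
  rewrite add0n [in RHS](eq_count (a2 := fun s' : state => s'.1.1)).
    by rewrite !addnA [(_ + 'C(_, 2))%N]addnC; lia.
  by move=> s' /=; case: s'.1.1.
rewrite add0n [X in _ = (X + _)%N](eq_count (a2 := fun s' : state => ~~ s'.1.1)).
  by lia.
by move=> s' /=; case: s'.1.1.
Qed.

(** Common form of both moves: the lowest state [s0] is removed by [wronsk_cons]. The maps [f] and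
    [g] let the shift act on either side, and [q] accounts for a common factor. Each state with the
    same power type as [s0] yields one factor x, exactly the change of [xdeg]. *)
Lemma wequiv_step al be s0 l (f g : state -> state) (c : state -> R) q :
  s0.2 = 0%N ->
  {in l, forall s, [/\ (f s).1.1 = s.1.1, (g s).1.1 = s.1.1, c s != 0,
    euler (seed al (f s)).1
      + ((seed al (f s)).2 - (seed al s0).2) * (seed al (f s)).1
      = c s *: ('X^(s.1.1 == s0.1.1) * (seed be (g s)).1)
    & (seed al (f s)).2 - (seed al s0).2 + (s.1.1 == s0.1.1)%:R
      = (seed be (g s)).2 - q]} ->
  wequiv al (s0 :: map f l) be (map g l).
Proof.
move=> s00 H.
have xdegE h : {in l, forall s, (h s).1.1 = s.1.1} -> xdeg (map h l) = xdeg l.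
  move=> hl; rewrite /xdeg !count_map.
  by congr ('C(_, _) + 'C(_, _))%N; apply: eq_in_count => s /hl /= ->.
exists (\prod_(s <- l) c s).
  by rewrite prodf_seq_neq0; apply/allP=> s /H[].
rewrite xdeg_cons !xdegE; [|by move=> s /H[] ..].
rewrite exprD [_ * 'X^(xdeg _)]mulrC -mulrA scalerAr; congr (_ * _).
rewrite count_map (eq_in_count (a2 := fun s => s.1.1 == s0.1.1)); last first.
  by move=> s /H[/= -> _ _ _ _].
rewrite /seed_wronsk /= !size_map.
have -> : seed al s0 = (1, (seed al s0).2).
  rewrite /seed s00 /laguerre_sgn laguerre0.
  by case: ifP => // _; rewrite -[1]/(1%:P) comp_polyC.
rewrite wronsk_cons -[in RHS](@wronsk_map_shift _ _ q); last by rewrite !size_map.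
rewrite /wronsk -map_comp.
(* The factor to be extracted from row i: a constant, and x when the power types agree. *)
pose u (i : 'I_(size l)) : {poly R} :=
  (c (nth s0 l i))%:P * 'X^((nth s0 l i).1.1 == s0.1.1).
set l' := [seq (f.1, f.2 - q) | f <- _].
have -> : (\prod_(s <- l) c s) *: ('X^(count (fun s => s.1.1 == s0.1.1) l) *
    wronsk (size l) (fun=> 0) l') = (\prod_i u i) * wronsk (size l) (fun=> 0) l'.
  rewrite big_split /= prodrXr -mul_polyC mulrA; congr (_ * 'X^_ * _).
    by rewrite rmorph_prod /= (big_nth s0) big_mkord.
  rewrite -sum1_count (big_nth s0) big_mkord big_mkcond.
  by apply: eq_bigr => i _; case: eqP.
rewrite /wronsk /l' -det_row_scale; congr (\det _).
apply/matrixP=> i j; rewrite !mxE -!map_comp.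
rewrite !(nth_map s0) //=; set s := nth s0 l i.
have /H[_ _ _ -> qE] : s \in l by rewrite mem_nth.
by rewrite tower_scale qE -mul_polyC mulrA.
Qed.

End Seeds.

(** * Maya diagrams and the involution I *)

Section Maya.
Implicit Types (F : seq nat) (s p : nat).

(* A finite set F of occupied nonnegative positions, all negative positions
   being occupied too, seen from the origin s: occupied positions at or above
   s, and empty positions below s counted downwards from s - 1. *)
Definition high F s := [seq (f - s)%N | f <- F & (s <= f)%N].
Definition holes F s := [seq (s - p.+1)%N | p <- iota 0 s & p \notin F].

Lemma high0 F : high F 0 = F.
Proof. by rewrite /high filter_predT (eq_map subn0) map_id. Qed.

Lemma high_out F s : s \notin F -> high F s = map succn (high F s.+1).
Proof.
move=> sF; rewrite /high (eq_in_filter (a2 := fun f => s < f)%N).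
  rewrite -map_comp; apply/eq_in_map => f.
  by rewrite mem_filter => /andP[sf _] /=; rewrite subnSK.
by move=> f fF; rewrite leq_eqVlt; case: eqP fF sF => // -> ->.
Qed.

Lemma high_in F s : uniq F -> s \in F ->
  perm_eq (high F s) (0%N :: map succn (high F s.+1)).
Proof.
move=> uF sF.
have /(perm_map (subn^~ s)) : perm_eq [seq f <- F | s <= f]%N
    (s :: [seq f <- F | s < f]%N).
  apply: uniq_perm; rewrite /= ?mem_filter ?ltnn ?filter_uniq // => f.
  rewrite !inE !mem_filter leq_eqVlt [f == s]eq_sym andb_orl.
  by case: eqP => // <-; rewrite sF.
rewrite /= subnn; congr (perm_eq _ (_ :: _)).
rewrite /high -map_comp; apply/eq_in_map => f.
by rewrite mem_filter => /andP[sf _] /=; rewrite subnSK.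
Qed.

Lemma holesS F s :
  holes F s.+1 = map succn (holes F s) ++ (if s \in F then [::] else [:: 0%N]).
Proof.
rewrite /holes -[in iota _ _]addn1 iotaD filter_cat map_cat -!map_comp /=.
congr (_ ++ _); last by case: (s \in F) => //=; rewrite subnn.
apply/eq_in_map => p; rewrite mem_filter mem_iota => /andP[_ ps] /=.
by rewrite -subSn.
Qed.

(** The natural number M_A + 1, equal to 0 for the empty set: the least origin above all of A. *)
Definition fset_top (A : {fset nat}) : nat :=
  if A == fset0 then 0%N else (\max_(f <- A) f).+1.

Lemma maxF_top (A : {fset nat}) : maxF A + 1 = (fset_top A)%:Z.
Proof. by rewrite /maxF /fset_top; case: eqP => // _; lia. Qed.

Lemma fset_top_gt (A : {fset nat}) f : f \in A -> (f < fset_top A)%N.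
Proof.
rewrite /fset_top; case: eqP => [->|_ fA] //.
by rewrite ltnS; apply: (@leq_bigmax_seq _ _ xpredT id).
Qed.

Lemma perm_incr_seq (A : {fset nat}) : perm_eq (incr_seq A) A.
Proof. by rewrite /incr_seq perm_sort. Qed.

Lemma mem_incr_seq (A : {fset nat}) : incr_seq A =i A.
Proof. exact/perm_mem/perm_incr_seq. Qed.

Lemma incr_seq_uniq (A : {fset nat}) : uniq (incr_seq A).
Proof. by rewrite sort_uniq fset_uniq. Qed.

Lemma size_incr_seq (A : {fset nat}) : size (incr_seq A) = #|` A|.
Proof. by rewrite size_sort. Qed.

Lemma bigmax_mem F : F != [::] -> (\max_(f <- F) f)%N \in F.
Proof.
elim: F => // a [_ _|b F /(_ isT) IH _]; first by rewrite big_seq1 mem_head.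
by rewrite big_cons in_cons; case: leqP => _; rewrite ?IH ?orbT ?eqxx.
Qed.

(** With the origin at M + 1, an empty position p is counted as M - p. *)
Lemma holes_invol (A : {fset nat}) :
  perm_eq (holes (incr_seq A) (fset_top A)) (incr_seq (invol A)).
Proof.
apply: uniq_perm; first 1 last.
- exact: incr_seq_uniq.
- move=> i; rewrite mem_incr_seq /invol in_fsetD !inE mem_iota /=.
  rewrite /fset_top; case: (A =P fset0) => [->|/eqP A0].
    by rewrite big_seq_fset0 in_nil; case: i => [|i]; rewrite andbF.
  set M := (\max_(f <- A) f)%N.
  (* Since M is occupied, no hole is counted as 0, in agreement with I(A) starting at 1. *)
  have MA : M \in A by apply: bigmax_mem; rewrite -size_eq0 cardfs_eq0.
  apply/mapP/andP => [[p]|[/imfsetP iA /andP[i0 iM]]].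
    rewrite mem_filter mem_iota mem_incr_seq /= => /andP[pA pM] ->.
    have pM' : p != M by apply: contraNneq pA => ->.
    split; last by lia.
    apply/imfsetP => -[f /= fA]; have := fset_top_gt fA.
    rewrite /fset_top (negPf A0) => fM fp.
    by case/negP: pA; have -> : p = f by lia.
  exists (M - i)%N; last by lia.
  rewrite mem_filter mem_iota mem_incr_seq /=; apply/andP; split; last by lia.
  by apply/negP => MiA; apply: iA; exists (M - i)%N => //=; lia.
rewrite map_inj_in_uniq ?filter_uniq ?iota_uniq // => x y.
by rewrite !mem_filter !mem_iota => /andP[_ xs] /andP[_ ys]; lia.
Qed.

Lemma high_top (A : {fset nat}) : high (incr_seq A) (fset_top A) = [::].
Proof.
rewrite /high (eq_in_filter (a2 := pred0)) ?filter_pred0 // => f.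
by rewrite mem_incr_seq => /fset_top_gt; rewrite ltnNge => /negPf.
Qed.

Lemma high_cons N F s : high ((N + s)%N :: F) s = N :: high F s.
Proof. by rewrite /high /= leq_addl /= addnK. Qed.

Lemma holes_cons N F s : holes ((N + s)%N :: F) s = holes F s.
Proof.
congr map; apply: eq_in_filter => p; rewrite mem_iota in_cons => /andP[_ ps].
by case: eqP => // pE; lia.
Qed.

Lemma mem_invol (A : {fset nat}) i : i \in invol A -> (i < fset_top A)%N.
Proof.
rewrite -mem_incr_seq -(perm_mem (holes_invol A)) => /mapP[p].
by rewrite mem_filter mem_iota => /andP[_ ps] ->; lia.
Qed.

End Maya.

(** * Moving the origin of one Maya diagram *)

Section Shifts.
Variable R : realType.
Implicit Types (al : R) (sg : bool) (l O : seq state) (F : seq nat).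

Definition movable sg l :=
  all (fun s : state => ~~ s.1.1 && (s.1.2 == sg) ==> (0 < s.2)%N) l.

Lemma wequiv_up sg al l : movable sg l -> all (fun s => up_coef sg al s != 0) l ->
  wequiv al ((false, sg, 0%N) :: l) (al + 1) (map (shift sg) l).
Proof.
move=> /allP mv /allP cl; rewrite -{1}(map_id l).
apply: (wequiv_step (c := up_coef sg al) (q := (if sg then 'X else 0) - 1)) => //.
move=> s sl; split=> //; first exact: cl.
  by rewrite eqbF_neg; apply/euler_shift_up/mv.
by rewrite /seed /= eqbF_neg; case: s.1.1; rewrite /= ?polyCD ?polyC1; ring.
Qed.

Lemma wequiv_down sg al l :
  movable sg l -> all (fun s => down_coef sg al s != 0) l ->
  wequiv al l (al + 1) ((true, ~~ sg, 0%N) :: map (shift sg) l).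
Proof.
move=> /allP mv /allP cl; apply: wequiv_sym; rewrite -{2}(map_id l).
apply: (wequiv_step (c := down_coef sg al)
  (q := (if ~~ sg then 'X else 0) - (al + 1)%:P)) => //.
move=> s sl; split=> //; first exact: cl.
  by rewrite eqb_id; apply/euler_shift_down/mv.
by rewrite /seed /= eqb_id; case: s.1.1; rewrite /= ?polyCD ?polyC1; ring.
Qed.

(** Induction on the origin: an occupied position is removed by [wequiv_up], an empty one creates a
    dual state by [wequiv_down]. The states in [O] keep their level under [shift]; the last
    hypothesis keeps their coefficients nonzero. *)
Lemma wequiv_shifts sg F O al s : uniq F ->
  {in O, forall o, o.1.1 = (o.1.2 == sg)} ->
  (forall o k, o \in O -> (k < s)%N ->
     if o.1.1 then o.2%:R - (al + k%:R) != 0 else o.2%:R + (al + k%:R) + 1 != 0) ->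
  wequiv al (map (pair (false, sg)) F ++ O) (al + s%:R)
    (map (pair (false, sg)) (high F s) ++ map (pair (true, ~~ sg)) (holes F s) ++ O).
Proof.
move=> uF Ofix Onz; elim: s Onz => [|s IH] Onz.
  rewrite high0 addr0; exists 1; rewrite ?oner_neq0 // scale1r; congr (_ * _).
apply: wequiv_trans (IH _) _ => [o k oO ks|]; first exact/Onz/ltnW.
(* The list [l] below is the part common to both cases: the step goes from the lowest state followed
   by [l] to the shifted [l], or from [l] to the dual lowest state followed by the shifted [l]. *)
rewrite -natr1 addrA.
pose l := map (pair (false, sg)) (map succn (high F s.+1)) ++
  map (pair (true, ~~ sg)) (holes F s) ++ O.
have lshift : map (shift sg) l = map (pair (false, sg)) (high F s.+1) ++
    map (pair (true, ~~ sg)) (map succn (holes F s)) ++ O.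
  rewrite /l !map_cat -!map_comp; congr (_ ++ (_ ++ _)).
  - by apply: eq_map => n; rewrite /= /shift /= eqxx.
  - by apply: eq_map => n; rewrite /= /shift /=; case: (sg).
  rewrite -[RHS]map_id; apply/eq_in_map => -[[t e] n] /Ofix /= ->.
  by rewrite /shift /= eqxx.
have lmov : movable sg l.
  rewrite /movable /l !all_cat !all_map; apply/and3P; split; apply/allP => //=.
    by move=> n; rewrite implybT.
  by move=> o /Ofix ->; case: (_ == _).
have lup : all (fun s' => up_coef sg (al + s%:R) s' != 0) l.
  rewrite /l !all_cat !all_map; apply/and3P; split; apply/allP.
  - by move=> n _; rewrite /up_coef /=; case: (sg); rewrite ?oppr_eq0 oner_eq0.
  - by move=> n _; rewrite /up_coef /=; case: (sg); rewrite pnatr_eq0.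
  move=> o oO; move: (Onz o s oO (ltnSn s)) (Ofix o oO); rewrite /up_coef.
  by case: o.1.1 => [H <-|_ _] //; case: o.1.2; rewrite ?oppr_eq0 oner_eq0.
have ldown : all (fun s' => down_coef sg (al + s%:R) s' != 0) l.
  rewrite /l !all_cat !all_map; apply/and3P; split; apply/allP.
  - by move=> n _; rewrite /down_coef /= eqxx pnatr_eq0.
  - by move=> n _; rewrite /down_coef /=; case: (sg); rewrite ?oppr_eq0 oner_eq0.
  move=> o oO; move: (Onz o s oO (ltnSn s)) (Ofix o oO); rewrite /down_coef.
  by case: o.1.1 => [_ _|H <-] //; case: o.1.2; rewrite ?oppr_eq0 oner_eq0.
rewrite holesS; case: ifP => sF.
  rewrite cats0 -lshift; apply: wequiv_trans (wequiv_up lmov lup).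
  apply: wequiv_perm; rewrite -cat_cons perm_cat2r.
  exact: (perm_map (pair (false, sg)) (high_in uF sF)).
rewrite high_out ?sF //; apply: wequiv_trans (wequiv_down lmov ldown) _.
apply: wequiv_perm; rewrite lshift map_cat /= -cat1s -[in X in perm_eq _ X]catA.
by rewrite perm_catCA perm_cat2l perm_catCA.
Qed.

End Shifts.

(** * The two determinants of the theorem as Wronskians *)

Section Endpoints.
Variable R : realType.
Implicit Types (a al b : R) (h : nat -> {poly R}).

Lemma tower_deriv h p q j : (forall j, q - h j = - j%:R) ->
  tower h (p, q) j = 'X^j * p^`(j) :> {poly R}.
Proof.
move=> H; elim: j => [|j IH]; first by rewrite expr0 mul1r.
by rewrite /= IH H eulerM eulerXn /euler -derivnS exprS; ring.
Qed.

Lemma tower_exp h g b q j : (forall j, q - h j = 'X - j%:R) ->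
  tower h (laguerre g b \Po (- 'X), q) j =
  'X^j * (laguerre g (b + j%:R) \Po (- 'X)).
Proof.
move=> H; elim: j => [|j IH]; first by rewrite expr0 mul1r addr0.
rewrite /= IH H eulerM eulerXn (@euler_laguerre_exp _ true) /=.
by rewrite -natr1 addrA exprS /X_sgn; ring.
Qed.

(** Iterating (x^a L_N^a)' = (N + a) x^(a-1) L_N^(a-1) accumulates the falling factorial
    [wcoef N a j]. *)
Lemma tower_pow h N a q j : (forall j, q - h j = (a - j%:R)%:P) ->
  tower h (laguerre N a, q) j = wcoef N a j *: laguerre N (a - j%:R).
Proof.
move=> H; elim: j => [|j IH].
  by rewrite /wcoef gbinom0 mulr1 scale1r subr0.
rewrite /= IH H eulerZ (@euler_laguerre_pow _ false) /=.
have -> : wcoef N a j.+1 = wcoef N a j * (N%:R + (a - j%:R)).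
  by rewrite /wcoef factS natrM -mulrA mulrCA gbinomSr; ring.
have -> : a - j.+1%:R = a - j%:R - 1 by rewrite -natr1; ring.
by move: (wcoef N a j) => w; rewrite -!mul_polyC polyCM; ring.
Qed.

(** Column j contributes ['X^j] and the row of [s] contributes [u s]; the gauge [h] is free, but
    must serve all rows at once. *)
Lemma det_rows_seed n al h (r : state -> nat -> {poly R})
    (u : state -> {poly R}) (l : seq state) : size l = n ->
  (forall s j, s \in l -> (j < n)%N ->
     'X^j * r s j = u s * tower h (seed al s) j) ->
  'X^('C(n, 2)) * \det (rows_mx n (map r l)) =
  (\prod_(s <- l) u s) * seed_wronsk al l.
Proof.
move=> <- H; pose s0 : state := (false, false, 0%N).
rewrite /seed_wronsk -(wronsk_gauge _ h) /wronsk (big_nth s0) big_mkord.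
rewrite -(det_row_scale (fun i : 'I_(size l) => u (nth s0 l i))) -det_col_Xn.
congr (\det _); apply/matrixP=> i j; rewrite !mxE !(nth_map s0) //.
by rewrite H ?mem_nth.
Qed.

Lemma laguerre_pair_seed al (F1 F2 : {fset nat}) n :
  'X^('C((#|` F1| + #|` F2|).+1, 2)) * laguerre_pair al F1 F2 n =
  seed_wronsk al (map (pair (false, false)) (`|n%:Z - uF F1 F2|%N :: incr_seq F1)
    ++ map (pair (false, true)) (incr_seq F2)).
Proof.
set l := (_ ++ _).
pose r (s : state) j := if s.1.2 then laguerre s.2 (al + j%:R) \Po (- 'X)
  else (laguerre s.2 al)^`(j).
rewrite -[RHS]mul1r /laguerre_pair.
rewrite [X in rows_mx _ X](_ : _ = map r l); last first.
  by rewrite /l /= map_cat -!map_comp.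
rewrite (det_rows_seed (u := fun=> 1) (h := fun j => j%:R) (al := al)).
- by rewrite big1.
- by rewrite /l /= size_cat !size_map !size_incr_seq.
move=> s j; rewrite mem_cat => /orP[] /mapP[f _ ->] _; rewrite mul1r /r /seed /=.
  by rewrite tower_deriv // => i; ring.
by rewrite tower_exp // => i; ring.
Qed.

Lemma Rmx_seed a (G1 G2 : {fset nat}) N :
  'X^('C((#|` G1| + #|` G2|).+1, 2)) * \det (Rmx a G1 G2 N) =
  'X^(#|` G1| + #|` G2|) * seed_wronsk a ((false, false, N) ::
    map (pair (true, true)) (incr_seq G1) ++ map (pair (true, false)) (incr_seq G2)).
Proof.
set m := (#|` G1| + #|` G2|)%N; set l := (_ :: _).
pose r (s : state) j := if s.1.1 then
    if s.1.2 then laguerre s.2 (- a + j%:R) \Po (- 'X)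
    else (laguerre s.2 (- a))^`(j)
  else wcoef s.2 a j *: ('X^(m - j) * laguerre s.2 (a - j%:R)).
rewrite /Rmx [X in rows_mx _ X](_ : _ = map r l); last first.
  by rewrite /l /= map_cat -!map_comp.
(* This gauge amounts to multiplying all functions by x^a, which turns the first row into
   derivatives of x^a L_N^a and frees the others of x^(-a). *)
rewrite (det_rows_seed (u := fun s => if s.1.1 then 1 else 'X^m)
  (h := fun j => (j%:R - a)%:P) (al := a)).
- rewrite /l big_cons big_seq big1 ?mulr1 // => s.
  by rewrite mem_cat => /orP[] /mapP[g _ ->].
- by rewrite /l /= size_cat !size_map !size_incr_seq.
move=> s j; rewrite in_cons mem_cat => /orP[/eqP ->|/orP[] /mapP[g _ ->]];
  rewrite /r /seed /= => jm.
- rewrite tower_pow => [|i]; last by rewrite -polyC0; ring.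
  by rewrite -!scalerAr mulrA -exprD subnKC.
- by rewrite mul1r tower_exp // => i; rewrite polyCB polyC_natr; ring.
by rewrite mul1r tower_deriv // => i; rewrite polyCB polyC_natr; ring.
Qed.

End Endpoints.

(** * Shifting both diagrams past their maxima *)

Section Equivalence.
Variable R : realType.
Implicit Types al : R.

(** The diagram of [F1] is shifted first, with [F2] as spectator; then that of [F2], with N and the
    states of I(F1) as spectators. *)
Lemma wequiv_invol al (F1 F2 : {fset nat}) N :
  (forall k : nat, al != - k.+1%:R) ->
  wequiv al
    (map (pair (false, false)) ((N + fset_top F1)%N :: incr_seq F1)
      ++ map (pair (false, true)) (incr_seq F2))
    (al + (fset_top F1)%:R + (fset_top F2)%:R)
    ((false, false, N) :: map (pair (true, true)) (incr_seq (invol F1))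
      ++ map (pair (true, false)) (incr_seq (invol F2))).
Proof.
move=> hal; set s1 := fset_top F1; set s2 := fset_top F2.
have nz n k : n%:R + (al + k%:R) + 1 != 0.
  apply: contra (hal (n + k)%N) => /eqP E; apply/eqP.
  by rewrite -natr1 natrD; apply/eqP; rewrite -subr_eq0 -E; apply/eqP; ring.
apply: wequiv_trans (wequiv_shifts (s := s1) _ _ _) _.
- rewrite /= incr_seq_uniq andbT mem_incr_seq.
  by apply/negP => /fset_top_gt; rewrite /s1; lia.
- by move=> o /mapP[f _ ->].
- by move=> o k /mapP[f _ ->] _ /=.
rewrite high_cons high_top holes_cons.
apply: wequiv_trans (wequiv_perm _ (l' := map (pair (false, true)) (incr_seq F2)
  ++ (false, false, N) :: map (pair (true, true)) (incr_seq (invol F1))) _) _.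
  rewrite perm_sym perm_catC /= perm_cons perm_cat2r perm_sym.
  exact/perm_map/holes_invol.
apply: wequiv_trans (wequiv_shifts (s := s2) (sg := true) _ _ _) _.
- exact: incr_seq_uniq.
- by move=> o; rewrite in_cons => /orP[/eqP ->|/mapP[f _ ->]].
- move=> o k; rewrite in_cons => /orP[/eqP -> _|/mapP[m + ->] _] /=.
    by rewrite -(addrA al) -natrD.
  rewrite mem_incr_seq => /mem_invol ms.
  (* A zero coefficient would give al = -(s1 + k - m), a negative integer because m < s1. *)
  have := hal (s1 + k - m).-1; apply: contra => /eqP E.
  rewrite prednK; last by rewrite /s1; lia.
  rewrite natrB ?natrD; last by rewrite /s1; lia.
  by rewrite -subr_eq0 -oppr_eq0; apply/eqP; rewrite -[RHS]E; ring.
rewrite high_top /=; apply: wequiv_perm.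
rewrite perm_catC /= perm_cons perm_cat2l.
exact/perm_map/holes_invol.
Qed.

End Equivalence.

Theorem mainTheorem12 (R : realType) (alpha : R) (F1 F2 : {fset nat})
    (halpha : forall k : nat, alpha != - k.+1%:R)
    (hF1 : pos_set F1) (hF2 : pos_set F2)
    (hF : F1 != fset0 \/ F2 != fset0)
    (hadm : admissible (alpha + 1) F1 F2)
    (n : nat) (hn : vF F1 F2 <= n%:Z) :
  exists gamma : R, gamma != 0 /\
    laguerre_pair alpha F1 F2 n =
      gamma *: \det (Rmx (alpha_tilde alpha F1 F2) (invol F1) (invol F2)
                         `|n%:Z - vF F1 F2|%N).
Proof.
set N := `|n%:Z - vF F1 F2|%N.
(* As v_F - u_F = M_(F1) + 1, the first index is N counted from the shifted origin. *)
have nE : `|n%:Z - uF F1 F2|%N = (N + fset_top F1)%N.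
  by have := maxF_top F1; rewrite /N; move: hn; rewrite /vF; lia.
have aE : alpha_tilde alpha F1 F2 = alpha + (fset_top F1)%:R + (fset_top F2)%:R.
  rewrite !pmulrn -!maxF_top /alpha_tilde !rmorphD /=; ring.
have [c c0 E] := wequiv_invol F1 F2 N halpha.
(* The constant of the equivalence is gamma: the powers of x on the two sides turn out equal and
   cancel. *)
exists c; split=> //.
set a := alpha_tilde _ _ _ in aE *; rewrite -{}aE in E.
have L := laguerre_pair_seed alpha F1 F2 n; rewrite nE in L.
have Xreg k : injective ( *%R ('X^k : {poly R})).
  by apply: mulfI; rewrite expf_neq0 ?polyX_eq0.
have := Rmx_seed a (invol F1) (invol F2) N.
(* Since C(m+1, 2) = C(m, 2) + m, the factor x^m of the first row cancels. *)
rewrite binS bin1 addnC exprD -mulrA => /Xreg RW.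
have count_const (b : bool) (A : {fset nat}) :
    count (fun=> b) (incr_seq A) = (b * #|` A|)%N.
  by rewrite -size_incr_seq; case: b; rewrite ?count_predT ?count_pred0 ?mul1n.
move: E; rewrite -L -{}RW /xdeg /= !count_cat !count_map /=.
rewrite !count_const /= !mul1n !mul0n !addn0 !add0n ?bin0n ?addn0 add1n.
by rewrite mulrCA scalerAr => /Xreg; rewrite scalerAr => /Xreg.
Qed.
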